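(* $$\sum_{n=0}^{\infty}n^2(n-1)(9n+1)\frac{\mathrm{Domb}(n)}{(-32)^n}=\frac{4}{3\pi}.$$
   Context: The Domb numbers are $\mathrm{Domb}(n)=\sum_{k=0}^n \binom{n}{k}^2\binom{2k}{k}\binom{2(n-k)}{n-k}$ for $n\ge 0$. *)

(* Defs.v *)
From Stdlib Require Import Reals.
Open Scope R_scope.

(* [sum_f_R0 f n] is the sum over 0 <= k <= n. [Binomial.C] is the real-valued
   binomial coefficient, correct only for lower index <= upper index, which
   always holds here; it is qualified because Coquelicot also exports a [C]. *)
Definition Domb (n : nat) : R :=
  sum_f_R0 (fun k : nat =>
    Binomial.C n k ^ 2 * Binomial.C (2 * k) k
      * Binomial.C (2 * (n - k)) (n - k)) n.

(* Main.v *)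
(* With D = Domb and d n = (-1)^n D n, the generating series g of d satisfies
     (1 + 16 v) g(v) = F(108 v / (1 + 16 v)^3)   for 0 <= v < 1/32,
   where F = 3F2 (1/2, 1/3, 2/3; 1, 1; x): both sides solve the same third-order
   equation, regular singular at 0 and with the same initial value.  The argument
   108 v / (1 + 16 v)^3 reaches 1 exactly at v = 1/32, with 1 minus it vanishing to
   second order, so that the derivative of the left side at 1/32 is read off the
   singular behaviour  x F'(x) ~ (sqrt 3 / (2 PI)) / sqrt (1 - x);  the constant
   comes from  prod (1 - 1 / (9 k^2)) = sin (PI/3) / (PI/3).  This yields
   sum (3 n + 1) d n / 32^n = 2 / PI.  The differential equation of g at v = 1/32
   and its first derivative reduce the quartic weight to a multiple of 3 n + 1. *)

Require Import Defs.
From Stdlib Require Import Factorial Reals Lra Lia.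
From Coquelicot Require Import Coquelicot.
Open Scope R_scope.


(** * The three-term recurrence of the Domb numbers and their growth *)

(* D n / n!^2 is the self-convolution of the sequence [domb_factor], whose third-order
   Euler equation makes the moments below close up into the recurrence of D. *)
Definition domb_factor (k : nat) : R := INR (fact (2 * k)) / INR (fact k) ^ 4.

Definition domb_moment (i j n : nat) : R :=
  sum_f_R0 (fun k => (INR k ^ i * domb_factor k)
                     * (INR (n - k) ^ j * domb_factor (n - k))) n.

Lemma INR_fact_S (n : nat) : INR (fact (S n)) = (INR n + 1) * INR (fact n).
Proof. now rewrite fact_simpl, mult_INR, S_INR. Qed.

Lemma domb_factor_succ (k : nat) :
  INR (S k) ^ 3 * domb_factor (S k) = (4 * INR k + 2) * domb_factor k.
Proof.
  unfold domb_factor.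
  replace (2 * S k)%nat with (S (S (2 * k))) by lia.
  rewrite !INR_fact_S, !S_INR, mult_INR; change (INR 2) with 2.
  pose proof (INR_fact_neq_0 k). pose proof (pos_INR k).
  field. split; [assumption | lra].
Qed.

Lemma domb_factor_ge0 (k : nat) : 0 <= domb_factor k.
Proof.
  unfold domb_factor. apply Rdiv_le_0_compat; [apply pos_INR |].
  apply pow_lt, INR_fact_lt_0.
Qed.


Lemma domb_moment_sym (i j n : nat) : domb_moment i j n = domb_moment j i n.
Proof.
  unfold domb_moment. rewrite <- sum_f_R0_skip. apply sum_eq. intros k Hk.
  replace (n - (n - k))%nat with k by lia. ring.
Qed.

(** Leibniz rule for the Euler operator on a product: split n as k + (n - k) under the sum. *)
Lemma domb_moment_add (i j n : nat) :
  INR n * domb_moment i j n = domb_moment (S i) j n + domb_moment i (S j) n.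
Proof.
  unfold domb_moment. rewrite <- plus_sum, scal_sum. apply sum_eq. intros k Hk.
  rewrite minus_INR by assumption. cbn [pow]. ring.
Qed.

(** The weight k^3 kills the term k = 0 and is exactly the factor that [domb_factor_succ] consumes
    to lower the index. *)
Lemma domb_moment_shift (j n : nat) :
  domb_moment 3 j (S n) = 4 * domb_moment 1 j n + 2 * domb_moment 0 j n.
Proof.
  unfold domb_moment. rewrite decomp_sum by lia. cbn [pred].
  change (INR 0) with 0.
  rewrite !scal_sum, <- plus_sum, Rmult_assoc.
  replace (0 ^ 3) with 0 by ring. rewrite Rmult_0_l, Rplus_0_l. apply sum_eq. intros k _.
  rewrite domb_factor_succ. change (S n - S k)%nat with (n - k)%nat. ring.
Qed.

Lemma domb_moment_2_0 (n : nat) :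
  6 * domb_moment 2 0 (S n)
  = (INR n + 1) ^ 2 * domb_moment 0 0 (S n) + 8 * domb_moment 0 0 n.
Proof.
  pose proof (domb_moment_add 0 0 (S n)) as H00.
  pose proof (domb_moment_add 1 0 (S n)) as H10.
  pose proof (domb_moment_add 2 0 (S n)) as H20.
  pose proof (domb_moment_add 1 1 (S n)) as H11.
  pose proof (domb_moment_shift 0 n) as H3.
  pose proof (domb_moment_add 0 0 n) as H0.
  rewrite (domb_moment_sym 0 1) in *. rewrite (domb_moment_sym 1 2) in *.
  rewrite S_INR in *. pose proof (pos_INR n).
  apply Rmult_eq_reg_l with (INR n + 1); [| lra].
  set (N := INR n) in *.
  (* By symmetry the (1, 0) moment at n is n/2 times the (0, 0) one, so the shift yields 4 (n/2) + 2
     = 2 (n + 1), and the factor n + 1 cancels throughout. *)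
  replace (domb_moment 3 0 (S n)) with (2 * (N + 1) * domb_moment 0 0 n) in H20 by lra.
  nra.
Qed.

(** Write M i j for the moments. The source is (n + 2) M 2 2 = 2 M 3 2 at index n + 2. The shift
    lowers M 3 2 to index n + 1, while M 2 2 descends through M 2 1 and M 2 0 to M 0 0, up to M 3 1
    and M 3 0, which the shift also lowers. What remains at n + 1 reduces by symmetry and
    [domb_moment_2_0]. *)
Lemma domb_moment_rec (n : nat) :
  (INR n + 2) ^ 5 * domb_moment 0 0 (S (S n))
  = 2 * (2 * INR n + 3) * (5 * INR n ^ 2 + 15 * INR n + 12) * domb_moment 0 0 (S n)
    - 64 * (INR n + 1) * domb_moment 0 0 n.
Proof.
  pose proof (domb_moment_2_0 (S n)) as Hp2.
  pose proof (domb_moment_2_0 n) as Hp1.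
  pose proof (domb_moment_add 0 0 (S n)) as A00.
  pose proof (domb_moment_add 1 0 (S n)) as A10.
  pose proof (domb_moment_add 1 1 (S n)) as A11.
  pose proof (domb_moment_add 2 0 (S (S n))) as B20.
  pose proof (domb_moment_add 2 1 (S (S n))) as B21.
  pose proof (domb_moment_add 2 2 (S (S n))) as B22.
  pose proof (domb_moment_shift 0 (S n)) as S0.
  pose proof (domb_moment_shift 1 (S n)) as S1.
  pose proof (domb_moment_shift 2 (S n)) as S2.
  rewrite (domb_moment_sym 0 1) in *. rewrite (domb_moment_sym 1 2) in *.
  rewrite (domb_moment_sym 0 2) in *. rewrite (domb_moment_sym 2 3) in *.
  rewrite !S_INR in *. pose proof (pos_INR n).
  set (N := INR n) in *.
  replace (domb_moment 3 0 (S (S n)))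
    with (2 * (N + 2) * domb_moment 0 0 (S n)) in B20 by lra.
  replace (domb_moment 2 2 (S (S n))) with
    ((N + 2) * domb_moment 2 1 (S (S n)) - domb_moment 3 1 (S (S n))) in B22 by lra.
  replace (domb_moment 2 1 (S (S n))) with
    ((N + 2) * domb_moment 2 0 (S (S n)) - 2 * (N + 2) * domb_moment 0 0 (S n)) in * by lra.
  replace (domb_moment 2 0 (S (S n))) with
    (((N + 2) ^ 2 * domb_moment 0 0 (S (S n)) + 8 * domb_moment 0 0 (S n)) / 6) in * by lra.
  rewrite S1, S2 in B22.
  replace (domb_moment 2 1 (S n)) with ((N + 1) * domb_moment 1 1 (S n) / 2) in * by lra.
  replace (domb_moment 1 1 (S n)) with
    ((N + 1) * domb_moment 1 0 (S n) - domb_moment 2 0 (S n)) in * by lra.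
  replace (domb_moment 1 0 (S n)) with ((N + 1) * domb_moment 0 0 (S n) / 2) in * by lra.
  replace (domb_moment 2 0 (S n)) with
    (((N + 1) ^ 2 * domb_moment 0 0 (S n) + 8 * domb_moment 0 0 n) / 6) in * by lra.
  clear - B22. lra.
Qed.

Lemma Domb_moment (n : nat) : Domb n = INR (fact n) ^ 2 * domb_moment 0 0 n.
Proof.
  unfold Domb, domb_moment. rewrite scal_sum. apply sum_eq. intros k Hk.
  unfold Binomial.C, domb_factor.
  replace (2 * k - k)%nat with k by lia.
  replace (2 * (n - k) - (n - k))%nat with (n - k)%nat by lia.
  pose proof (INR_fact_neq_0 k). pose proof (INR_fact_neq_0 (n - k)).
  field. now split.
Qed.

Lemma Domb_rec (n : nat) :
  (INR n + 2) ^ 3 * Domb (S (S n))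
  = 2 * (2 * INR n + 3) * (5 * INR n ^ 2 + 15 * INR n + 12) * Domb (S n)
    - 64 * (INR n + 1) ^ 3 * Domb n.
Proof.
  rewrite !Domb_moment, !INR_fact_S, S_INR.
  pose proof (domb_moment_rec n) as H.
  transitivity (((INR n + 1) * INR (fact n)) ^ 2
    * ((INR n + 2) ^ 5 * domb_moment 0 0 (S (S n)))); [ring | rewrite H; ring].
Qed.

Lemma Domb_ge0 (n : nat) : 0 <= Domb n.
Proof.
  rewrite Domb_moment. apply Rmult_le_pos; [apply pow2_ge_0 |].
  apply cond_pos_sum. intros k.
  apply Rmult_le_pos; (apply Rmult_le_pos; [apply pow_le, pos_INR | apply domb_factor_ge0]).
Qed.

Lemma Domb_0 : Domb 0 = 1.
Proof. unfold Domb, Binomial.C; simpl; field. Qed.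

Lemma Domb_1 : Domb 1 = 4.
Proof. unfold Domb, Binomial.C; simpl; field. Qed.

(** Dropping the nonpositive last term of the recurrence leaves a ratio of at most 20, its leading
    coefficient. Since 20 < 32, the point 1/32 lies strictly inside the disk of convergence. *)
Lemma Domb_le (n : nat) : Domb n <= 20 ^ n.
Proof.
  induction n as [|[|n] IH]; [rewrite Domb_0; simpl; lra | rewrite Domb_1; simpl; lra |].
  apply Rle_trans with (20 * Domb (S n)); [| rewrite <- tech_pow_Rmult; lra].
  pose proof (Domb_rec n) as H. pose proof (Domb_ge0 n). pose proof (Domb_ge0 (S n)).
  pose proof (pos_INR n).
  assert (0 < (INR n + 2) ^ 3) by (apply pow_lt; lra).
  assert (0 <= 64 * (INR n + 1) ^ 3 * Domb n).
  { repeat apply Rmult_le_pos; try apply pow_le; lra. }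
  apply Rmult_le_reg_l with ((INR n + 2) ^ 3); [assumption |].
  rewrite H.
  apply Rle_trans with
    (2 * (2 * INR n + 3) * (5 * INR n ^ 2 + 15 * INR n + 12) * Domb (S n)); [lra |].
  rewrite <- Rmult_assoc. apply Rmult_le_compat_r; [assumption |].
  nra.
Qed.


(** * Power series under the Euler operator x d/dx *)

(** Coefficients of the k-th image of the series under x d/dx; since 0 ^ 0 = 1, [moment c 0] agrees
    with [c] at every index. *)
Definition moment (c : nat -> R) (k n : nat) : R := INR n ^ k * c n.

(** Each step is a derivative followed by a multiplication by x, and both keep the radius. *)
Lemma CV_radius_moment (c : nat -> R) (k : nat) :
  CV_radius (moment c k) = CV_radius c.
Proof.
  induction k as [|k IH].
  - apply CV_radius_ext. intros n. unfold moment. simpl. ring.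
  - rewrite <- IH, <- (CV_radius_derive (moment c k)),
      <- (CV_radius_incr_1 (PS_derive (moment c k))).
    apply CV_radius_ext. intros [|n].
    + unfold moment. simpl.  unfold zero; simpl.  ring.
    + unfold moment, PS_derive, PS_incr_1. cbn [pow].  ring.
Qed.

Lemma PSeries_moment_succ (c : nat -> R) (k : nat) (x : R) :
  PSeries (moment c (S k)) x = x * PSeries (PS_derive (moment c k)) x.
Proof.
  rewrite <- PSeries_incr_1. apply PSeries_ext. intros [|n].
  - unfold moment. simpl. unfold zero; simpl. ring.
  - unfold moment, PS_derive, PS_incr_1. cbn [pow].  ring.
Qed.

Lemma ex_derive_moment (c : nat -> R) (k : nat) (x : R) :
  Rbar_lt (Rabs x) (CV_radius c) -> ex_derive (PSeries (moment c k)) x.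
Proof. intros H. apply ex_derive_PSeries. now rewrite CV_radius_moment. Qed.

Lemma is_derive_moment (c : nat -> R) (k : nat) (x : R) :
  x <> 0 -> Rbar_lt (Rabs x) (CV_radius c) ->
  is_derive (PSeries (moment c k)) x (PSeries (moment c (S k)) x / x).
Proof.
  intros Hx H. rewrite PSeries_moment_succ.
  replace (x * _ / x) with (PSeries (PS_derive (moment c k)) x) by now field.
  apply is_derive_PSeries. now rewrite CV_radius_moment.
Qed.

Lemma is_pseries_moment (c : nat -> R) (k : nat) (x : R) :
  Rbar_lt (Rabs x) (CV_radius c) ->
  is_pseries (moment c k) x (PSeries (moment c k) x).
Proof.
  intros H. apply PSeries_correct, CV_radius_inside. now rewrite CV_radius_moment.
Qed.

Lemma is_pseries_quartic (c : nat -> R) (p0 p1 p2 p3 p4 x : R) :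
  Rbar_lt (Rabs x) (CV_radius c) ->
  is_pseries (fun n => (p0 + p1 * INR n + p2 * INR n ^ 2 + p3 * INR n ^ 3
                        + p4 * INR n ^ 4) * c n) x
    (p0 * PSeries (moment c 0) x + p1 * PSeries (moment c 1) x
     + p2 * PSeries (moment c 2) x + p3 * PSeries (moment c 3) x
     + p4 * PSeries (moment c 4) x).
Proof.
  intros H.
  assert (Hs : forall p k, is_pseries (PS_scal p (moment c k)) x
                             (p * PSeries (moment c k) x)).
  { intros p k. apply (is_pseries_scal (V := R_NormedModule)); [apply Rmult_comm |].
    now apply is_pseries_moment. }
  eapply is_pseries_ext;
    [| refine (is_pseries_plus _ _ _ _ _ (is_pseries_plus _ _ _ _ _ (is_pseries_plus _ _
         _ _ _ (is_pseries_plus _ _ _ _ _ (Hs p0 0%nat) (Hs p1 1%nat)) (Hs p2 2%nat))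
         (Hs p3 3%nat)) (Hs p4 4%nat))].
  intros n. unfold PS_plus, PS_scal, moment, plus, scal; simpl; unfold mult; simpl. ring.
Qed.

Lemma CV_radius_ge (c : nat -> R) (r M : R) :
  (forall n, Rabs (c n * r ^ n) <= M) -> Rbar_le r (CV_radius c).
Proof. intros H. apply (proj1 (CV_radius_bounded c)). now exists M. Qed.

Lemma CV_radius_gt_of_unit (c : nat -> R) (x : R) :
  (forall n, 0 <= c n <= 1) -> Rabs x < 1 -> Rbar_lt (Rabs x) (CV_radius c).
Proof.
  intros Hc H. apply Rbar_lt_le_trans with 1; [exact H |].
  apply CV_radius_ge with 1. intros n.
  rewrite pow1, Rmult_1_r, Rabs_pos_eq; apply Hc.
Qed.

(** Turns a recurrence into a differential equation. [PS_incr_1] carries the term of index n - 1,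
    with value 0 at n = 0; the constant term on the left vanishes because the exponent [S m] is
    positive. *)
Lemma PSeries_moment_of_rec (c : nat -> R) (m : nat)
    (p0 p1 p2 p3 p4 q0 q1 q2 q3 q4 x : R) :
  Rbar_lt (Rabs x) (CV_radius c) ->
  (forall n, moment c (S m) (S n)
     = (p0 + p1 * INR n + p2 * INR n ^ 2 + p3 * INR n ^ 3 + p4 * INR n ^ 4) * c n
       + PS_incr_1 (fun l => (q0 + q1 * INR l + q2 * INR l ^ 2 + q3 * INR l ^ 3
                              + q4 * INR l ^ 4) * c l) n) ->
  PSeries (moment c (S m)) x
  = x * (p0 * PSeries (moment c 0) x + p1 * PSeries (moment c 1) x
         + p2 * PSeries (moment c 2) x + p3 * PSeries (moment c 3) x
         + p4 * PSeries (moment c 4) x)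
    + x ^ 2 * (q0 * PSeries (moment c 0) x + q1 * PSeries (moment c 1) x
               + q2 * PSeries (moment c 2) x + q3 * PSeries (moment c 3) x
               + q4 * PSeries (moment c 4) x).
Proof.
  intros Hx Hrec.
  pose proof (is_pseries_plus _ _ _ _ _ (is_pseries_quartic c p0 p1 p2 p3 p4 x Hx)
    (is_pseries_incr_1 _ _ _ (is_pseries_quartic c q0 q1 q2 q3 q4 x Hx))) as H.
  apply is_pseries_ext with (b := PS_decr_1 (moment c (S m))) in H;
    [| intros n; symmetry; apply Hrec].
  apply is_pseries_unique in H.
  rewrite PSeries_decr_1_aux, H by (unfold moment; simpl; ring).
  unfold plus, scal; simpl; unfold mult; simpl. ring.
Qed.

(** * The signed Domb series and its differential equation *)

Definition domb_alt (n : nat) : R := (-1) ^ n * Domb n.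

Lemma CV_radius_domb_alt (v : R) :
  Rabs v < / 20 -> Rbar_lt (Rabs v) (CV_radius domb_alt).
Proof.
  intros H. apply Rbar_lt_le_trans with (/ 20); [exact H |].
  apply CV_radius_ge with 1. intros n. unfold domb_alt.
  rewrite !Rabs_mult, pow_1_abs, Rmult_1_l, pow_inv.
  rewrite Rabs_pos_eq by apply Domb_ge0.
  assert (0 < 20 ^ n) by (apply pow_lt; lra).
  rewrite Rabs_pos_eq by (left; now apply Rinv_0_lt_compat).
  apply Rmult_le_reg_r with (20 ^ n); [assumption |].
  rewrite Rmult_assoc, Rinv_l by lra. pose proof (Domb_le n). lra.
Qed.

(** With [PS_incr_1] vanishing at 0, the case n = 0 absorbs the initial value d 1 = -4 d 0, so one
    formula serves all n. *)
Lemma domb_alt_rec (n : nat) :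
  (INR n + 1) ^ 3 * domb_alt (S n)
  = - ((4 + 18 * INR n + 30 * INR n ^ 2 + 20 * INR n ^ 3) * domb_alt n)
    - 64 * PS_incr_1 (fun m => (INR m + 1) ^ 3 * domb_alt m) n.
Proof.
  destruct n as [|n].
  - unfold domb_alt. rewrite Domb_0, Domb_1. simpl. unfold zero; simpl. ring.
  - unfold PS_incr_1, domb_alt. rewrite S_INR. cbn [pow].
    pose proof (Domb_rec n) as H.
    transitivity ((-1) ^ n * ((INR n + 2) ^ 3 * Domb (S (S n)))); [ring |].
    rewrite H. ring.
Qed.

Notation domb_series k := (PSeries (moment domb_alt k)).


Lemma domb_series_3 (v : R) : Rabs v < / 20 ->
  domb_series 3 v
  = v * (-4 * domb_series 0 v + -18 * domb_series 1 v + -30 * domb_series 2 v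
         + -20 * domb_series 3 v + 0 * domb_series 4 v)
    + v ^ 2 * (-64 * domb_series 0 v + -192 * domb_series 1 v + -192 * domb_series 2 v
               + -64 * domb_series 3 v + 0 * domb_series 4 v).
Proof.
  intros Hv%CV_radius_domb_alt. apply PSeries_moment_of_rec; [exact Hv |].
  intros n. unfold moment. rewrite S_INR, domb_alt_rec.
  destruct n; unfold PS_incr_1; [change zero with 0 |]; ring.
Qed.

(** The recurrence multiplied by n + 1, that is, v d/dv applied to the third-order equation. *)
Lemma domb_series_4 (v : R) : Rabs v < / 20 ->
  domb_series 4 v
  = v * (-4 * domb_series 0 v + -22 * domb_series 1 v + -48 * domb_series 2 v
         + -50 * domb_series 3 v + -20 * domb_series 4 v)
    + v ^ 2 * (-128 * domb_series 0 v + -448 * domb_series 1 v + -576 * domb_series 2 v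
               + -320 * domb_series 3 v + -64 * domb_series 4 v).
Proof.
  intros Hv%CV_radius_domb_alt. apply PSeries_moment_of_rec; [exact Hv |].
  intros n. unfold moment.
  transitivity ((INR n + 1) * ((INR n + 1) ^ 3 * domb_alt (S n)));
    [rewrite S_INR; ring | rewrite domb_alt_rec].
  destruct n as [|n]; unfold PS_incr_1; [change zero with 0 | rewrite S_INR]; ring.
Qed.

(** * The hypergeometric series F *)

(** Equal to (1/2)_n (1/3)_n (2/3)_n / n!^3 in Pochhammer symbols. *)
Definition cubic_coef (n : nat) : R :=
  INR (fact (3 * n)) * INR (fact (2 * n)) / (INR (fact n) ^ 5 * 108 ^ n).

(** The polynomial on the right is (n + 1/2) (n + 1/3) (n + 2/3). *)
Lemma cubic_coef_rec (n : nat) :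
  (INR n + 1) ^ 3 * cubic_coef (S n)
  = (1 / 9 + 13 / 18 * INR n + 3 / 2 * INR n ^ 2 + INR n ^ 3) * cubic_coef n.
Proof.
  unfold cubic_coef.
  replace (3 * S n)%nat with (S (S (S (3 * n)))) by lia.
  replace (2 * S n)%nat with (S (S (2 * n))) by lia.
  rewrite !INR_fact_S, !S_INR, !mult_INR; change (INR 2) with 2; change (INR 3) with (2 + 1).
  pose proof (INR_fact_neq_0 n). pose proof (pos_INR n).
  assert (108 ^ n <> 0) by (apply pow_nonzero; lra).
  cbn [pow]. field. repeat split; (assumption || lra).
Qed.

Lemma cubic_coef_ge0 (n : nat) : 0 <= cubic_coef n.
Proof.
  unfold cubic_coef. apply Rdiv_le_0_compat.
  - apply Rmult_le_pos; apply pos_INR.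
  - apply Rmult_lt_0_compat; apply pow_lt; [apply INR_fact_lt_0 | lra].
Qed.

Lemma cubic_coef_le1 (n : nat) : cubic_coef n <= 1.
Proof.
  induction n as [|n IH].
  - unfold cubic_coef. simpl. lra.
  - pose proof (cubic_coef_rec n) as H. pose proof (cubic_coef_ge0 n). pose proof (pos_INR n).
    assert (0 < (INR n + 1) ^ 3) by (apply pow_lt; lra).
    apply Rmult_le_reg_l with ((INR n + 1) ^ 3); [assumption |].
    rewrite H. apply Rmult_le_compat; [nra | assumption | nra | assumption].
Qed.

Lemma CV_radius_cubic (x : R) :
  Rabs x < 1 -> Rbar_lt (Rabs x) (CV_radius cubic_coef).
Proof.
  apply CV_radius_gt_of_unit. intros n.
  split; [apply cubic_coef_ge0 | apply cubic_coef_le1].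
Qed.

Notation cubic_series k := (PSeries (moment cubic_coef k)).

Lemma cubic_series_3 (x : R) : Rabs x < 1 ->
  (1 - x) * cubic_series 3 x
  = x * (1 / 9 * cubic_series 0 x + 13 / 18 * cubic_series 1 x + 3 / 2 * cubic_series 2 x).
Proof.
  intros Hx%CV_radius_cubic.
  assert (H := PSeries_moment_of_rec cubic_coef 2 (1 / 9) (13 / 18) (3 / 2) 1 0
                 0 0 0 0 0 x Hx).
  lapply H; [lra |].
  intros n. unfold moment. rewrite S_INR, cubic_coef_rec.
  destruct n; unfold PS_incr_1; [change zero with 0 |]; ring.
Qed.


(** * Uniqueness at a regular singular point by an energy estimate *)

(** The chain terms cost at most E itself, since E - 2 (ab + 4bc) = a^2/2 + (a - 2b)^2/2 + 2 (b -
    2c)^2. The feedback through q carries a factor v, so the crude constant 32 suffices there. *)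
Lemma energy_bound (a b c r q M v : R) :
  0 <= r <= 1 -> 0 <= q <= M * v ->
  2 * r * (a * b + 4 * (b * c) + 8 * (c * (q * (3 / 2 * c + 13 / 18 * b + 1 / 9 * a))))
  <= (1 + 32 * M * v) * (a ^ 2 + 4 * b ^ 2 + 8 * c ^ 2).
Proof.
  intros Hr Hq.
  set (E := a ^ 2 + 4 * b ^ 2 + 8 * c ^ 2).
  set (T := c * (3 / 2 * c + 13 / 18 * b + 1 / 9 * a)).
  assert (HE : 0 <= E) by (unfold E; nra).
  assert (H1 : 2 * (a * b + 4 * (b * c)) <= E).
  { unfold E. pose proof (pow2_ge_0 (a - 2 * b)). pose proof (pow2_ge_0 (b - 2 * c)). nra. }
  assert (H2 : 16 * T <= 32 * E).
  { unfold E, T. pose proof (pow2_ge_0 (c - b)). pose proof (pow2_ge_0 (c - a)).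
    pose proof (pow2_ge_0 a). pose proof (pow2_ge_0 b). pose proof (pow2_ge_0 c). nra. }
  assert (H3 : 16 * (q * T) <= 32 * M * v * E).
  { apply Rle_trans with (q * (32 * E)); [nra |].
    replace (32 * M * v * E) with (M * v * (32 * E)) by ring.
    apply Rmult_le_compat_r; lra. }
  assert (H4 : 0 <= 32 * M * v * E).
  { apply Rmult_le_pos; [| assumption]. lra. }
  replace (2 * r * _) with (r * (2 * (a * b + 4 * (b * c)) + 16 * (q * T))) by (unfold T; ring).
  apply Rle_trans with (r * (E + 32 * M * v * E)); [| nra].
  apply Rmult_le_compat_l; lra.
Qed.

(* Uniqueness at a regular singular point: the weights 1, 4, 8 make the energy
   E = a^2 + 4b^2 + 8c^2 satisfy v E' <= (1 + O(v)) E, so that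
   E exp (- K v) / v is nonincreasing; it tends to 0 at 0 since E = O(v^2). *)
Lemma regular_singular_unique (a b c r q : R -> R) (M V : R) :
  (forall v, 0 < v < V -> 0 <= r v <= 1) ->
  (forall v, 0 < v < V -> 0 <= q v <= M * v) ->
  (forall v, 0 < v < V -> is_derive a v (r v * b v / v)) ->
  (forall v, 0 < v < V -> is_derive b v (r v * c v / v)) ->
  (forall v, 0 < v < V ->
     is_derive c v (r v * (q v * (3 / 2 * c v + 13 / 18 * b v + 1 / 9 * a v)) / v)) ->
  ex_derive a 0 -> ex_derive b 0 -> ex_derive c 0 ->
  a 0 = 0 -> b 0 = 0 -> c 0 = 0 ->
  forall v, 0 < v < V -> a v = 0 /\ b v = 0.
Proof.
  intros Hr Hq Da Db Dc a'0 b'0 c'0 a0 b0 c0 v Hv.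
  set (E := fun s => a s ^ 2 + 4 * b s ^ 2 + 8 * c s ^ 2).
  set (K := 32 * M).
  set (h := fun s => - (E s * exp (- K * s) / s)).
  set (dh := fun s =>
    exp (- K * s) / s ^ 2 *
    ((1 + K * s) * E s -
     2 * r s * (a s * b s + 4 * (b s * c s)
       + 8 * (c s * (q s * (3 / 2 * c s + 13 / 18 * b s + 1 / 9 * a s)))))).
  assert (Dh : forall s, 0 < s < V -> is_derive h s (dh s)).
  { intros s Hs. pose proof (Da s Hs) as Ha. pose proof (Db s Hs) as Hb.
    pose proof (Dc s Hs) as Hc. unfold h, dh, E.
    auto_derive.
    - repeat split; try (now eexists; eassumption); lra.
    - rewrite (is_derive_unique (fun x : R => a x) _ _ Ha),
        (is_derive_unique (fun x : R => b x) _ _ Hb), (is_derive_unique (fun x : R => c x) _ _ Hc).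
      field. lra. }
  assert (Hdh : forall s, 0 < s < V -> 0 <= dh s).
  { intros s Hs. unfold dh. apply Rmult_le_pos.
    - apply Rdiv_le_0_compat; [left; apply exp_pos | apply pow_lt; lra].
    - pose proof (energy_bound (a s) (b s) (c s) _ _ _ _ (Hr s Hs) (Hq s Hs)).
      unfold K, E. lra. }
  assert (Hmono : forall s, 0 < s <= v -> h s <= h v).
  { intros s Hs.
    destruct (MVT_gen h s v dh) as [t [Ht Heq]];
      rewrite ?Rmin_left, ?Rmax_right in * by lra.
    - intros t Ht. apply Dh. lra.
    - intros t Ht. apply derivable_continuous_pt. exists (dh t).
      apply is_derive_Reals, Dh. lra.
    - assert (0 <= dh t * (v - s)) by (apply Rmult_le_pos; [apply Hdh |]; lra). lra. }
  (* As a, b, c are differentiable and zero at 0, E s / s tends to 0; by monotonicity this limit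
     bounds the quantity at v. *)
  assert (HE : is_derive E 0 0).
  { unfold E. auto_derive; [tauto |]. rewrite a0, b0, c0. ring. }
  apply is_derive_Reals in HE.
  assert (HK : 0 <= K).
  { unfold K. pose proof (Hq v Hv). nra. }
  assert (Hle : E v * exp (- K * v) / v <= 0).
  { apply le_epsilon. intros eps Heps.
    destruct (HE eps Heps) as [d Hd].
    set (s := Rmin v (d / 2)).
    pose proof (cond_pos d) as Hdpos.
    assert (Hs : 0 < s <= v).
    { unfold s. split; [apply Rmin_pos; lra | apply Rmin_l]. }
    assert (Hs2 : s <= d / 2) by apply Rmin_r.
    pose proof (Hmono s Hs) as Hm. unfold h in Hm.
    assert (Es : 0 <= E s) by (unfold E; nra).
    specialize (Hd s ltac:(lra) ltac:(rewrite Rabs_pos_eq; lra)).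
    rewrite Rplus_0_l, Rminus_0_r in Hd.
    assert (E0 : E 0 = 0) by (unfold E; rewrite a0, b0, c0; ring).
    rewrite E0, Rminus_0_r in Hd.
    apply Rabs_lt_between in Hd.
    assert (exp (- K * s) <= 1).
    { rewrite <- exp_0. destruct (Req_dec (K * s) 0) as [H0 | H0].
      - replace (- K * s) with 0 by lra. lra.
      - left. apply exp_increasing. nra. }
    assert (E s * exp (- K * s) / s <= E s / s).
    { unfold Rdiv. apply Rmult_le_compat_r; [left; apply Rinv_0_lt_compat; lra |].
      pose proof (exp_pos (- K * s)). nra. }
    lra. }
  assert (Ev : E v <= 0).
  { apply Rmult_le_reg_r with (exp (- K * v) / v).
    - apply Rdiv_lt_0_compat; [apply exp_pos | lra].
    - unfold Rdiv in *. rewrite Rmult_0_l. lra. }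
  unfold E in Ev.
  pose proof (pow2_ge_0 (a v)). pose proof (pow2_ge_0 (b v)). pose proof (pow2_ge_0 (c v)).
  split; apply Rsqr_0_uniq; unfold Rsqr; nra.
Qed.

(** * The cubic change of variable from v to x *)

Definition pull (v : R) : R := 108 * v / (1 + 16 * v) ^ 3.

(** The logarithmic derivative v pull' / pull, which converts v d/dv into x d/dx. *)
Definition pull_log (v : R) : R := (1 - 32 * v) / (1 + 16 * v).

Lemma pull_compl (v : R) : 0 <= v ->
  1 - pull v = (1 - 32 * v) ^ 2 * (1 + 4 * v) / (1 + 16 * v) ^ 3.
Proof. intros H. unfold pull. field. lra. Qed.

Lemma pull_bounds (v : R) : 0 <= v < / 32 -> 0 <= pull v < 1.
Proof.
  intros H. split.
  - unfold pull. apply Rdiv_le_0_compat; [lra | apply pow_lt; lra].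
  - apply Rlt_0_minus. rewrite pull_compl by lra.
    apply Rdiv_lt_0_compat; [apply Rmult_lt_0_compat; [apply pow_lt |] | apply pow_lt]; lra.
Qed.

Lemma is_derive_pull (v : R) : 0 < v ->
  is_derive pull v (pull v * pull_log v / v).
Proof.
  intros H. unfold pull, pull_log. auto_derive.
  - repeat apply Rmult_integral_contrapositive_currified; lra.
  - field. lra.
Qed.

Lemma is_derive_cubic_pull (k : nat) (v : R) : 0 < v < / 32 ->
  is_derive (fun s => cubic_series k (pull s)) v
    (pull_log v * cubic_series (S k) (pull v) / v).
Proof.
  intros H. pose proof (pull_bounds v ltac:(lra)) as Hp.
  assert (Hpos : 0 < pull v).
  { unfold pull. apply Rdiv_lt_0_compat; [lra | apply pow_lt; lra]. }
  assert (D : is_derive (cubic_series k) (pull v) (cubic_series (S k) (pull v) / pull v)).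
  { apply is_derive_moment; [lra |]. apply CV_radius_cubic. rewrite Rabs_pos_eq; lra. }
  replace (pull_log v * _ / v) with
    (pull v * pull_log v / v * (cubic_series (S k) (pull v) / pull v)) by (field; lra).
  apply (is_derive_comp (cubic_series k) pull); [exact D | apply is_derive_pull; lra].
Qed.

Lemma ex_derive_cubic_pull (k : nat) : ex_derive (fun s => cubic_series k (pull s)) 0.
Proof.
  apply (ex_derive_comp (cubic_series k) pull).
  - apply ex_derive_moment, CV_radius_cubic. unfold pull.
    replace (108 * 0 / _) with 0 by field. rewrite Rabs_R0. lra.
  - unfold pull. auto_derive. lra.
Qed.

(* [lift_1] and [lift_2] are the images of [lift_0] under the derivation
   (v / pull_log v) d/dv, which corresponds to x d/dx through x = pull v;
   the g_k stand for the series with coefficients n^k d n. *)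
Definition lift_0 (g0 : R -> R) (v : R) : R := (1 + 16 * v) * g0 v.
Definition lift_1 (g0 g1 : R -> R) (v : R) : R :=
  (1 + 16 * v) * (16 * v * g0 v + (1 + 16 * v) * g1 v) / (1 - 32 * v).
Definition lift_2 (g0 g1 g2 : R -> R) (v : R) : R :=
  (1 + 16 * v) / (1 - 32 * v) *
  ((16 * v * (16 * v * g0 v + (1 + 16 * v) * g1 v)
    + (1 + 16 * v) * (16 * v * g0 v + 32 * v * g1 v + (1 + 16 * v) * g2 v)) / (1 - 32 * v)
   + 32 * v * (1 + 16 * v) * (16 * v * g0 v + (1 + 16 * v) * g1 v) / (1 - 32 * v) ^ 2).

(* pull v / (1 - pull v) *)
Definition pull_odds (v : R) : R := 108 * v / ((1 - 32 * v) ^ 2 * (1 + 4 * v)).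

Lemma is_derive_lift_0 (g0 g1 : R -> R) (v : R) :
  0 < v < / 32 -> is_derive g0 v (g1 v / v) ->
  is_derive (lift_0 g0) v (pull_log v * lift_1 g0 g1 v / v).
Proof.
  intros Hv D0. unfold lift_0, lift_1, pull_log. auto_derive; [now eexists; eassumption |].
  rewrite (is_derive_unique (fun x : R => g0 x) _ _ D0). field. lra.
Qed.

Lemma is_derive_lift_1 (g0 g1 g2 : R -> R) (v : R) :
  0 < v < / 32 -> is_derive g0 v (g1 v / v) -> is_derive g1 v (g2 v / v) ->
  is_derive (lift_1 g0 g1) v (pull_log v * lift_2 g0 g1 g2 v / v).
Proof.
  intros Hv D0 D1. unfold lift_1, lift_2, pull_log. auto_derive;
    [repeat split; try (now eexists; eassumption); lra |].
  rewrite (is_derive_unique (fun x : R => g0 x) _ _ D0), (is_derive_unique (fun x : R => g1 x) _ _ D1). field. lra.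
Qed.

(** Here the equation of g enters: substituted for g3, it closes the three lifts into the
    first-order system that F and its Euler derivatives satisfy along [pull]. *)
Lemma is_derive_lift_2 (g0 g1 g2 g3 : R -> R) (v : R) :
  0 < v < / 32 -> is_derive g0 v (g1 v / v) -> is_derive g1 v (g2 v / v) ->
  is_derive g2 v (g3 v / v) ->
  g3 v = v * (-4 * g0 v + -18 * g1 v + -30 * g2 v + -20 * g3 v)
         + v ^ 2 * (-64 * g0 v + -192 * g1 v + -192 * g2 v + -64 * g3 v) ->
  is_derive (lift_2 g0 g1 g2) v
    (pull_log v * (pull_odds v * (3 / 2 * lift_2 g0 g1 g2 v + 13 / 18 * lift_1 g0 g1 v
                                  + 1 / 9 * lift_0 g0 v)) / v).
Proof.
  intros Hv D0 D1 D2 ode.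
  (* Collecting g3 gives the coefficient 1 + 20 v + 64 v^2 = (1 + 4 v) (1 + 16 v). *)
  assert (E : g3 v = (v * (-4 * g0 v + -18 * g1 v + -30 * g2 v)
         + v ^ 2 * (-64 * g0 v + -192 * g1 v + -192 * g2 v)) / ((1 + 4 * v) * (1 + 16 * v))).
  { apply Rmult_eq_reg_r with ((1 + 4 * v) * (1 + 16 * v)); [| nra].
    unfold Rdiv at 1. rewrite Rmult_assoc, Rinv_l by nra. lra. }
  unfold lift_0, lift_1, lift_2, pull_log, pull_odds. auto_derive;
    [repeat split; try (now eexists; eassumption); try lra; nra |].
  rewrite (is_derive_unique (fun x : R => g0 x) _ _ D0), (is_derive_unique (fun x : R => g1 x) _ _ D1),
    (is_derive_unique (fun x : R => g2 x) _ _ D2), E.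
  field. lra.
Qed.


(** The differences between the lifts of g and the pulled-back series of F solve the homogeneous
    system and vanish at 0. The first-derivative level is kept because its singularity at 1/32 is
    the one evaluated later. *)
Lemma lift_1_eq_cubic (v : R) : 0 < v < / 32 ->
  lift_1 (domb_series 0) (domb_series 1) v = cubic_series 1 (pull v).
Proof.
  intros Hv.
  (* Stopping strictly before 1/32 keeps [pull_odds s / s] bounded, by 108 / (1 - 32 V)^2. *)
  set (V := (v + / 32) / 2).
  assert (HV : 0 < v < V /\ V < / 32) by (unfold V; lra).
  assert (HD : forall k s, 0 < s < V ->
            is_derive (domb_series k) s (domb_series (S k) s / s)).
  { intros k s Hs. apply is_derive_moment; [lra |].
    apply CV_radius_domb_alt. rewrite Rabs_pos_eq; lra. }
  assert (HD0 : forall k, ex_derive (fun s : R => domb_series k s) 0).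
  { intros k. apply (ex_derive_moment domb_alt). apply CV_radius_domb_alt.
    rewrite Rabs_R0. lra. }
  assert (HC0 : forall k, ex_derive (fun s : R => cubic_series k (pull s)) 0)
    by apply ex_derive_cubic_pull.
  assert (p0 : pull 0 = 0) by (unfold pull; field).
  set (a := fun s => lift_0 (domb_series 0) s - cubic_series 0 (pull s)).
  set (b := fun s => lift_1 (domb_series 0) (domb_series 1) s - cubic_series 1 (pull s)).
  set (c := fun s => lift_2 (domb_series 0) (domb_series 1) (domb_series 2) s
                     - cubic_series 2 (pull s)).
  assert (H : a v = 0 /\ b v = 0); [| unfold b in H; lra].
  apply (regular_singular_unique a b c pull_log pull_odds (108 / (1 - 32 * V) ^ 2) V);
    try tauto; unfold a, b, c.
  - intros s Hs. unfold pull_log. split.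
    + apply Rdiv_le_0_compat; lra.
    + apply Rle_div_l; lra.
  - intros s Hs. unfold pull_odds. split.
    + apply Rdiv_le_0_compat; [lra |].
      apply Rmult_lt_0_compat; [apply pow_lt |]; lra.
    + assert (0 < (1 - 32 * V) ^ 2) by (apply pow_lt; lra).
      assert ((1 - 32 * V) ^ 2 <= (1 - 32 * s) ^ 2 * (1 + 4 * s)).
      { apply Rle_trans with ((1 - 32 * s) ^ 2 * 1).
        - rewrite Rmult_1_r. apply pow_incr. lra.
        - apply Rmult_le_compat_l; [apply pow2_ge_0 | lra]. }
      replace (108 / (1 - 32 * V) ^ 2 * s) with (108 * s / (1 - 32 * V) ^ 2) by (field; lra).
      unfold Rdiv. apply Rmult_le_compat_l; [lra |]. now apply Rinv_le_contravar.
  - intros s Hs.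
    replace (pull_log s * _ / s) with
      (pull_log s * lift_1 (domb_series 0) (domb_series 1) s / s
       - pull_log s * cubic_series 1 (pull s) / s) by (field; lra).
    apply (is_derive_minus (V := R_NormedModule)).
    + apply is_derive_lift_0; [lra | now apply HD].
    + apply is_derive_cubic_pull. lra.
  - intros s Hs.
    replace (pull_log s * _ / s) with
      (pull_log s * lift_2 (domb_series 0) (domb_series 1) (domb_series 2) s / s
       - pull_log s * cubic_series 2 (pull s) / s) by (field; lra).
    apply (is_derive_minus (V := R_NormedModule)).
    + apply is_derive_lift_1; [lra | |]; now apply HD.
    + apply is_derive_cubic_pull. lra.
  - intros s Hs.
    assert (Hp : 0 <= pull s < 1) by (apply pull_bounds; lra).
    assert (Hc : cubic_series 3 (pull s) = pull_odds s *
              (1 / 9 * cubic_series 0 (pull s) + 13 / 18 * cubic_series 1 (pull s)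
               + 3 / 2 * cubic_series 2 (pull s))).
    { apply Rmult_eq_reg_l with (1 - pull s); [| lra].
      rewrite cubic_series_3 by (rewrite Rabs_pos_eq; lra).
      rewrite <- Rmult_assoc. f_equal.
      rewrite pull_compl by lra. unfold pull, pull_odds. field. lra. }
    replace (pull_log s * _ / s) with
      (pull_log s * (pull_odds s *
         (3 / 2 * lift_2 (domb_series 0) (domb_series 1) (domb_series 2) s
          + 13 / 18 * lift_1 (domb_series 0) (domb_series 1) s
          + 1 / 9 * lift_0 (domb_series 0) s)) / s
       - pull_log s * cubic_series 3 (pull s) / s) by (rewrite Hc; field; lra).
    apply (is_derive_minus (V := R_NormedModule)).
    + apply (is_derive_lift_2 _ _ _ (domb_series 3)); [lra | now apply HD .. |].
      rewrite (domb_series_3 s) at 1 by (rewrite Rabs_pos_eq; lra). ring.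
    + apply is_derive_cubic_pull. lra.
  - apply (ex_derive_minus (V := R_NormedModule)); [| apply HC0].
    unfold lift_0. auto_derive. apply HD0.
  - apply (ex_derive_minus (V := R_NormedModule)); [| apply HC0].
    unfold lift_1. auto_derive. repeat split; try apply HD0; lra.
  - apply (ex_derive_minus (V := R_NormedModule)); [| apply HC0].
    unfold lift_2. auto_derive. repeat split; try apply HD0; lra.
  - unfold lift_0. rewrite p0, !PSeries_0. unfold moment, domb_alt, cubic_coef.
    rewrite Domb_0. simpl. field.
  - unfold lift_1. rewrite p0, !PSeries_0. unfold moment. simpl. field.
  - unfold lift_2. rewrite p0, !PSeries_0. unfold moment. simpl. field.
Qed.


(** * Wallis integrals and the product for sin (PI/3) *)

(** Relative to z = 0, the recurrence in n contributes factors 1 - z^2 / (2k)^2, which are 1 - 1 /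
    (9 k^2) at z = 2/3. *)
Definition wallis (z : R) (n : nat) : R :=
  RInt (fun x => cos (z * x) * cos x ^ (2 * n)) 0 (PI / 2).

Lemma ex_RInt_wallis (z : R) (n : nat) (a b : R) :
  ex_RInt (fun x => cos (z * x) * cos x ^ (2 * n)) a b.
Proof.
  apply (ex_RInt_continuous (V := R_CompleteNormedModule)). intros x _.
  apply (ex_derive_continuous (V := R_NormedModule)). auto_derive. exact I.
Qed.

Lemma wallis_rec (z : R) (n : nat) :
  ((2 * INR n + 2) ^ 2 - z ^ 2) * wallis z (S n)
  = (2 * INR n + 2) * (2 * INR n + 1) * wallis z n.
Proof.
  (* Up to sign, the boundary term of two integrations by parts; it vanishes at PI/2 through the
     cosine and at 0 through the sines. *)
  set (F := fun x => cos x ^ (2 * n + 1)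
                     * ((2 * INR n + 2) * (sin x * cos (z * x)) - z * (cos x * sin (z * x)))).
  set (f := fun x =>
    ((2 * INR n + 2) ^ 2 - z ^ 2) * (cos (z * x) * cos x ^ (2 * S n))
    - (2 * INR n + 2) * (2 * INR n + 1) * (cos (z * x) * cos x ^ (2 * n))).
  assert (HF : is_RInt f 0 (PI / 2) (F (PI / 2) - F 0)).
  { apply (is_RInt_derive (V := R_CompleteNormedModule)).
    - intros x _. unfold F, f. auto_derive; [exact I |].
      replace (n + (n + 0) + 1)%nat with (S (2 * n)) by lia.
      replace (2 * S n)%nat with (S (S (2 * n))) by lia.
      cbn [pow Init.Nat.pred]. rewrite S_INR, mult_INR. change (INR 2) with 2.
      pose proof (sin2_cos2 x) as Hsc. unfold Rsqr in Hsc.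
      apply Rminus_diag_uniq.
      transitivity (- (2 * INR n + 2) * (2 * INR n + 1) * cos x ^ (2 * n) * cos (z * x)
                    * (sin x * sin x + cos x * cos x - 1)); [ring | rewrite Hsc; ring].
    - intros x _. apply (ex_derive_continuous (V := R_NormedModule)).
      unfold f. auto_derive. exact I. }
  assert (H0 : F (PI / 2) - F 0 = 0).
  { unfold F. rewrite cos_PI2, Nat.add_1_r, sin_0, Rmult_0_r, sin_0. simpl. ring. }
  rewrite H0 in HF.
  assert (HG : is_RInt f 0 (PI / 2)
    (((2 * INR n + 2) ^ 2 - z ^ 2) * wallis z (S n)
     - (2 * INR n + 2) * (2 * INR n + 1) * wallis z n)).
  { apply (is_RInt_minus (V := R_NormedModule));
      apply (is_RInt_scal (V := R_NormedModule)), (RInt_correct (V := R_CompleteNormedModule)),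
        ex_RInt_wallis. }
  apply (is_RInt_unique (V := R_CompleteNormedModule)) in HF, HG.
  rewrite HF in HG. lra.
Qed.

Lemma wallis_0_0 : wallis 0 0 = PI / 2.
Proof.
  unfold wallis. rewrite (RInt_ext _ (fun _ => 1)).
  - rewrite RInt_const. unfold scal; simpl; unfold mult; simpl. ring.
  - intros x _. rewrite Rmult_0_l, cos_0. simpl. ring.
Qed.

Lemma wallis_third_0 : wallis (2 / 3) 0 = 3 * sqrt 3 / 4.
Proof.
  unfold wallis. apply is_RInt_unique.
  replace (3 * sqrt 3 / 4) with
    (3 / 2 * sin (2 / 3 * (PI / 2)) - 3 / 2 * sin (2 / 3 * 0)).
  - apply (is_RInt_derive (V := R_CompleteNormedModule) (fun x => 3 / 2 * sin (2 / 3 * x))).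
    + intros x _. auto_derive; [exact I |]. simpl. field.
    + intros x _. apply (ex_derive_continuous (V := R_NormedModule)). auto_derive. exact I.
  - replace (2 / 3 * (PI / 2)) with (PI / 3) by field.
    rewrite Rmult_0_r, sin_0, sin_PI3. field.
Qed.

Lemma wallis_0_pos (n : nat) : 0 < wallis 0 n.
Proof.
  induction n as [|n IH].
  - rewrite wallis_0_0. pose proof PI_RGT_0. lra.
  - pose proof (wallis_rec 0 n) as H. pose proof (pos_INR n).
    apply Rmult_lt_reg_l with ((2 * INR n + 2) ^ 2 - 0 ^ 2); [nra |].
    rewrite H. rewrite Rmult_0_r. apply Rmult_lt_0_compat; [nra | exact IH].
Qed.

(* cos^2 x <= cos x <= cos (2x/3) <= 1 on the interval of integration. *)
Lemma wallis_squeeze (n : nat) :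
  wallis 0 (S n) <= wallis (2 / 3) n <= wallis 0 n.
Proof.
  pose proof PI_RGT_0.
  split; apply RInt_le; try apply ex_RInt_wallis; try lra; intros x Hx;
    rewrite Rmult_0_l, cos_0, Rmult_1_l;
    assert (0 < cos x) by (apply cos_gt_0; lra);
    assert (0 < cos x ^ (2 * n)) by now apply pow_lt.
  - replace (2 * S n)%nat with (S (S (2 * n))) by lia. cbn [pow].
    pose proof (COS_bound x).
    assert (cos x < cos (2 / 3 * x)) by (apply cos_decreasing_1; lra).
    rewrite <- Rmult_assoc. apply Rmult_le_compat_r; nra.
  - pose proof (COS_bound (2 / 3 * x)). nra.
Qed.

(* The partial products of  prod (1 - 1 / (9 k^2)). *)
Definition third_prod (n : nat) : R :=
  INR (fact (3 * n)) * (3 * INR n + 1) / (27 ^ n * INR (fact n) ^ 3).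

Lemma third_prod_succ (n : nat) :
  third_prod (S n)
  = (9 * (INR n + 1) ^ 2 - 1) / (9 * (INR n + 1) ^ 2) * third_prod n.
Proof.
  unfold third_prod.
  replace (3 * S n)%nat with (S (S (S (3 * n)))) by lia.
  rewrite !INR_fact_S, !S_INR, !mult_INR; change (INR 3) with (2 + 1).
  pose proof (INR_fact_neq_0 n). pose proof (pos_INR n).
  assert (27 ^ n <> 0) by (apply pow_nonzero; lra).
  cbn [pow]. field. repeat split; (assumption || lra).
Qed.

(** The factors of [third_prod] cancel those in the recurrence of the integral at 2/3; the case n =
    0 fixes the constant as sin (PI/3) / (PI/3). *)
Lemma third_prod_wallis (n : nat) :
  third_prod n * wallis (2 / 3) n = 3 * sqrt 3 / (2 * PI) * wallis 0 n.
Proof.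
  pose proof PI_RGT_0.
  induction n as [|n IH].
  - rewrite wallis_0_0, wallis_third_0. unfold third_prod. simpl. field. lra.
  - pose proof (wallis_rec 0 n) as H0. pose proof (wallis_rec (2 / 3) n) as H1.
    pose proof (pos_INR n). rewrite third_prod_succ.
    apply Rmult_eq_reg_l with ((2 * INR n + 2) ^ 2); [| nra].
    transitivity (third_prod n *
      (((2 * INR n + 2) ^ 2 - (2 / 3) ^ 2) * wallis (2 / 3) (S n))); [field; lra |].
    rewrite H1.
    transitivity ((2 * INR n + 2) * (2 * INR n + 1) *
      (third_prod n * wallis (2 / 3) n)); [ring |].
    rewrite IH.
    transitivity (3 * sqrt 3 / (2 * PI) *
      (((2 * INR n + 2) ^ 2 - 0 ^ 2) * wallis 0 (S n))); [rewrite H0; ring | ring].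
Qed.

Lemma sqrt3_PI_pos : 0 < sqrt 3 / (2 * PI).
Proof.
  pose proof PI_RGT_0. pose proof (sqrt_lt_R0 3 ltac:(lra)).
  apply Rdiv_lt_0_compat; lra.
Qed.

(** The integral at 2/3 is squeezed between two consecutive Wallis integrals, whose quotient is (2n
    + 1) / (2n + 2). *)
Lemma third_prod_bounds (n : nat) (L := 3 * sqrt 3 / (2 * PI)) :
  L <= third_prod n <= L * (2 * INR n + 2) / (2 * INR n + 1).
Proof.
  pose proof (wallis_squeeze n) as [Hl Hu]. pose proof (third_prod_wallis n) as E.
  fold L in E. pose proof (wallis_0_pos n). pose proof (wallis_0_pos (S n)).
  pose proof (pos_INR n). pose proof (wallis_rec 0 n) as Hrec.
  assert (0 < L).
  { pose proof sqrt3_PI_pos. pose proof PI_RGT_0.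
    replace L with (3 * (sqrt 3 / (2 * PI))) by (unfold L; field; lra). lra. }
  assert (Hp : 0 < third_prod n).
  { apply Rmult_lt_reg_r with (wallis (2 / 3) n); [lra |]. rewrite E, Rmult_0_l.
    now apply Rmult_lt_0_compat. }
  split.
  - apply Rmult_le_reg_r with (wallis 0 n); [assumption |].
    rewrite <- E. now apply Rmult_le_compat_l; [left |].
  - apply (proj1 (Rle_div_r _ _ (2 * INR n + 1) ltac:(lra))).
    apply Rmult_le_reg_r with (wallis 0 n); [assumption |].
    replace (L * (2 * INR n + 2) * wallis 0 n) with
      ((2 * INR n + 2) * (third_prod n * wallis (2 / 3) n)) by (rewrite E; ring).
    apply Rle_trans with ((2 * INR n + 2) * (third_prod n * wallis 0 (S n))).
    + assert (HJ : (2 * INR n + 1) * wallis 0 n = (2 * INR n + 2) * wallis 0 (S n)).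
      { apply Rmult_eq_reg_l with (2 * INR n + 2); [| lra]. lra. }
      rewrite Rmult_assoc, HJ. lra.
    + apply Rmult_le_compat_l; [lra |]. now apply Rmult_le_compat_l; [left |].
Qed.

(** * Singular behaviour of x F'(x) at x = 1 *)

(** The Taylor coefficients of 1 / sqrt (1 - x). *)
Definition central_coef (n : nat) : R :=
  INR (fact (2 * n)) / (4 ^ n * INR (fact n) ^ 2).

Lemma central_coef_rec (n : nat) :
  (INR n + 1) * central_coef (S n) = (1 / 2 + INR n) * central_coef n.
Proof.
  unfold central_coef.
  replace (2 * S n)%nat with (S (S (2 * n))) by lia.
  rewrite !INR_fact_S, !S_INR, !mult_INR; change (INR 2) with 2.
  pose proof (INR_fact_neq_0 n). pose proof (pos_INR n).
  assert (4 ^ n <> 0) by (apply pow_nonzero; lra).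
  cbn [pow]. field. repeat split; (assumption || lra).
Qed.

Lemma central_coef_ge0 (n : nat) : 0 <= central_coef n.
Proof.
  apply Rdiv_le_0_compat; [apply pos_INR |].
  apply Rmult_lt_0_compat; apply pow_lt; [lra | apply INR_fact_lt_0].
Qed.

Lemma central_coef_0 : central_coef 0 = 1.
Proof. unfold central_coef. simpl. field. Qed.

(** Makes an error of relative size 1 / (n + 1) telescope. *)
Lemma central_coef_drop (n : nat) :
  central_coef n / (INR n + 1) = 2 * (central_coef n - central_coef (S n)).
Proof.
  pose proof (central_coef_rec n). pose proof (pos_INR n).
  apply Rmult_eq_reg_l with (INR n + 1); [| lra].
  replace ((INR n + 1) * (central_coef n / (INR n + 1))) with (central_coef n) by (field; lra).
  lra.
Qed.

Lemma central_coef_le1 (n : nat) : central_coef n <= 1.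
Proof.
  induction n as [|n IH]; [rewrite central_coef_0; lra |].
  pose proof (central_coef_drop n). pose proof (pos_INR n).
  assert (0 <= central_coef n / (INR n + 1))
    by (apply Rdiv_le_0_compat; [apply central_coef_ge0 | lra]).
  lra.
Qed.

Lemma CV_radius_central (x : R) :
  Rabs x < 1 -> Rbar_lt (Rabs x) (CV_radius central_coef).
Proof.
  apply CV_radius_gt_of_unit. intros n.
  split; [apply central_coef_ge0 | apply central_coef_le1].
Qed.

(** The recurrence reads 2 (1 - t) B' = B, so B(t) sqrt (1 - t) has zero derivative. *)
Lemma central_series (x : R) : 0 <= x < 1 ->
  PSeries (moment central_coef 0) x = / sqrt (1 - x).
Proof.
  intros Hx.
  set (B := PSeries (moment central_coef 0)).
  assert (Hs : forall t, 0 <= t < 1 -> 0 < sqrt (1 - t)) by (intros; apply sqrt_lt_R0; lra).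
  set (h := fun t => B t * sqrt (1 - t)).
  assert (Hh : h x = h 0).
  { destruct (MVT_gen h 0 x (fun _ => 0)) as [t [_ Ht]];
      rewrite ?Rmin_left, ?Rmax_right in * by lra; [| | lra].
    - intros t Ht.
      assert (Hr : Rbar_lt (Rabs t) (CV_radius central_coef))
        by (apply CV_radius_central; rewrite Rabs_pos_eq; lra).
      pose proof (is_derive_moment central_coef 0 t ltac:(lra) Hr) as D. fold B in D.
      assert (E := PSeries_moment_of_rec central_coef 0 (1 / 2) 1 0 0 0 0 0 0 0 0 t Hr).
      lapply E; clear E.
      2: { intros n. unfold moment. rewrite S_INR, pow_1, central_coef_rec.
           destruct n; unfold PS_incr_1; [change zero with 0 |]; ring. }
      fold B. intros E.
      assert (E' : PSeries (moment central_coef 1) t = t * B t / (2 * (1 - t))).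
      { apply Rmult_eq_reg_r with (2 * (1 - t)); [| lra].
        replace (t * B t / (2 * (1 - t)) * (2 * (1 - t))) with (t * B t) by (field; lra). lra. }
      unfold h. auto_derive; [split; [now eexists; apply D | split; [lra | exact I]] |].
      rewrite (is_derive_unique (fun y : R => B y) _ _ D), E'.
      pose proof (Hs t ltac:(lra)) as Ht0.
      pose proof (sqrt_sqrt (1 - t) ltac:(lra)) as Hss.
      replace (1 + - t) with (1 - t) by ring.
      set (w := sqrt (1 - t)) in *. rewrite <- Hss. field. lra.
    - intros t Ht.
      apply continuity_pt_filterlim, (ex_derive_continuous (V := R_NormedModule)).
      unfold h. auto_derive. split; [| split; [lra | exact I]].
      apply (ex_derive_moment central_coef), CV_radius_central. rewrite Rabs_pos_eq; lra. }
  unfold h in Hh. unfold B in Hh at 2. rewrite PSeries_0, Rminus_0_r, sqrt_1 in Hh.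
  unfold moment in Hh at 1. rewrite central_coef_0 in Hh. simpl in Hh.
  pose proof (Hs x Hx).
  apply Rmult_eq_reg_r with (sqrt (1 - x)); [| lra].
  rewrite Rinv_l by lra. lra.
Qed.

(** Splitting 108 = 27 * 4 factors n [cubic_coef n] as n / (3n + 1) times [third_prod n] times
    [central_coef n]; the first two factors multiply to L up to L / (n + 1). *)
Lemma cubic_coef_central (n : nat) (L := sqrt 3 / (2 * PI)) :
  Rabs (INR n * cubic_coef n - L * central_coef n)
  <= 2 * L * (central_coef n - central_coef (S n)).
Proof.
  pose proof (third_prod_bounds n) as Hb. cbv zeta in Hb.
  replace (3 * sqrt 3 / (2 * PI)) with (3 * L) in Hb
    by (unfold L; pose proof PI_RGT_0; field; lra).
  assert (HL : 0 < L) by apply sqrt3_PI_pos.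
  pose proof (pos_INR n).
  assert (E : INR n * cubic_coef n
              = INR n / (3 * INR n + 1) * third_prod n * central_coef n).
  { unfold cubic_coef, third_prod, central_coef.
    replace 108 with (27 * 4) by ring. rewrite Rpow_mult_distr.
    pose proof (INR_fact_neq_0 n).
    assert (4 ^ n <> 0) by (apply pow_nonzero; lra).
    assert (27 ^ n <> 0) by (apply pow_nonzero; lra).
    field. repeat split; (assumption || lra). }
  rewrite E, <- Rmult_minus_distr_r, Rabs_mult.
  rewrite (Rabs_pos_eq (central_coef n)) by apply central_coef_ge0.
  replace (2 * L * (central_coef n - central_coef (S n))) with
    (L / (INR n + 1) * central_coef n)
    by (pose proof (central_coef_drop n); unfold Rdiv in *; nra).
  apply Rmult_le_compat_r; [apply central_coef_ge0 |].
  apply Rabs_le. destruct Hb as [Hb1 Hb2].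
  set (T := third_prod n) in *. set (N := INR n) in *.
  split.
  - apply Rle_trans with (N / (3 * N + 1) * (3 * L) - L).
    + replace (N / (3 * N + 1) * (3 * L) - L) with (- (L / (3 * N + 1))) by (field; lra).
      apply Ropp_le_contravar. unfold Rdiv. apply Rmult_le_compat_l; [lra |].
      apply Rinv_le_contravar; lra.
    + apply Rplus_le_compat_r, Rmult_le_compat_l; [| lra].
      apply Rdiv_le_0_compat; lra.
  - apply Rle_trans with (N / (3 * N + 1) * (3 * L * (2 * N + 2) / (2 * N + 1)) - L).
    + apply Rplus_le_compat_r, Rmult_le_compat_l; [| lra].
      apply Rdiv_le_0_compat; lra.
    + replace (N / (3 * N + 1) * (3 * L * (2 * N + 2) / (2 * N + 1)) - L)
        with (L * ((N - 1) / ((3 * N + 1) * (2 * N + 1)))) by (field; lra).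
      unfold Rdiv at 2. apply Rmult_le_compat_l; [lra |].
      apply Rle_div_l; [nra |]. apply Rmult_le_reg_l with (N + 1); [lra |].
      rewrite <- Rmult_assoc, Rinv_r by lra. nra.
Qed.

(** The coefficient errors telescope to a sum of at most 2 L, uniformly in x, so subtracting the
    square-root singularity leaves a bounded remainder. *)
Lemma cubic_series_singular (x : R) (L := sqrt 3 / (2 * PI)) : 0 <= x < 1 ->
  Rabs (cubic_series 1 x - L / sqrt (1 - x)) <= 2 * L.
Proof.
  intros Hx.
  assert (HL : 0 < L) by apply sqrt3_PI_pos.
  assert (Ha : Rabs x < 1) by (rewrite Rabs_pos_eq; lra).
  unfold Rdiv. rewrite <- (central_series x Hx).
  pose proof (is_pseries_moment _ 1 x (CV_radius_cubic x Ha)) as H1.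
  pose proof (is_pseries_moment _ 0 x (CV_radius_central x Ha)) as H2.
  rewrite is_pseries_R in H1, H2.
  apply (is_series_scal_l (K := R_AbsRing) L) in H2.
  pose proof (is_series_minus _ _ _ _ H1 H2) as H.
  set (u := fun n => moment cubic_coef 1 n * x ^ n - L * (moment central_coef 0 n * x ^ n)).
  change (is_series u (cubic_series 1 x - L * PSeries (moment central_coef 0) x)) in H.
  assert (Hu : forall n, Rabs (u n) <= 2 * L * (central_coef n - central_coef (S n))).
  { intros n. eapply Rle_trans; [| apply cubic_coef_central].
    set (A := INR n * cubic_coef n - L * central_coef n).
    replace (u n) with (A * x ^ n) by (unfold u, moment, A; simpl; ring).
    apply Rle_trans with (Rabs A * 1); [| rewrite Rmult_1_r; apply Rle_refl].
    rewrite Rabs_mult.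
    apply Rmult_le_compat_l; [apply Rabs_pos |].
    rewrite Rabs_pos_eq by (apply pow_le; lra).
    rewrite <- (pow1 n). apply pow_incr. lra. }
  apply (is_lim_seq_abs _ (Finite _)) in H.
  refine (is_lim_seq_le _ (fun _ => 2 * L) _ (2 * L) _ H (is_lim_seq_const _)).
  intros N.
  apply Rle_trans with (2 * L * (1 - central_coef (S N)));
    [| pose proof (central_coef_ge0 (S N)); nra].
  induction N as [|N IH].
  - rewrite sum_O, <- central_coef_0. apply Hu.
  - rewrite sum_Sn. eapply Rle_trans; [apply Rabs_triang |].
    pose proof (Hu (S N)). lra.
Qed.


(** * Evaluation at v = 1/32 *)

Lemma continuous_zero_of_linear_bound (f : R -> R) (p K : R) : 0 < p ->
  continuous f p -> (forall v, 0 < v < p -> Rabs (f v) <= K * (p - v)) -> f p = 0.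
Proof.
  intros Hp Hf Hb.
  destruct (Req_dec (f p) 0) as [H0 | H0]; [exact H0 | exfalso].
  apply continuity_pt_filterlim in Hf.
  pose proof (Rabs_pos_lt _ H0) as He.
  destruct (Hf (Rabs (f p) / 2) ltac:(lra)) as [d [Hd Hc]].
  unfold dist in Hc; simpl in Hc; unfold R_dist in Hc.
  set (K' := Rabs K + 1).
  assert (HK : 0 < K') by (unfold K'; pose proof (Rabs_pos K); lra).
  (* At distance m below p, continuity costs less than half of |f p| and the linear bound less than
     the other half, a contradiction. *)
  set (m := Rmin (Rmin (d / 2) (p / 2)) (Rabs (f p) / (2 * K'))).
  assert (Hm : 0 < m).
  { repeat apply Rmin_pos; try lra. apply Rdiv_lt_0_compat; lra. }
  assert (m <= d / 2) by (eapply Rle_trans; [apply Rmin_l | apply Rmin_l]).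
  assert (m <= p / 2) by (eapply Rle_trans; [apply Rmin_l | apply Rmin_r]).
  assert (Hm3 : m <= Rabs (f p) / (2 * K')) by apply Rmin_r.
  apply (proj2 (Rle_div_r _ _ (2 * K') ltac:(lra))) in Hm3.
  specialize (Hb (p - m) ltac:(lra)).
  replace (p - (p - m)) with m in Hb by ring.
  assert (Hl : Rabs (f (p - m) - f p) < Rabs (f p) / 2).
  { apply Hc. split; [split; [exact I | lra] |].
    replace (p - m - p) with (- m) by ring. rewrite Rabs_Ropp, Rabs_pos_eq; lra. }
  assert (K * m <= (K' - 1) * m).
  { apply Rmult_le_compat_r; [lra |]. unfold K'. pose proof (Rle_abs K). lra. }
  pose proof (Rabs_triang (f (p - m)) (- (f (p - m) - f p))) as Ht.
  replace (f (p - m) + - (f (p - m) - f p)) with (f p) in Ht by ring.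
  rewrite Rabs_Ropp in Ht. nra.
Qed.

Lemma domb_series_first_order :
  domb_series 0 (/ 32) + 3 * domb_series 1 (/ 32) = 2 / PI.
Proof.
  set (L := sqrt 3 / (2 * PI)).
  pose proof PI_RGT_0.
  assert (HL : 0 < L) by apply sqrt3_PI_pos.
  (* This is 1 - 32 v times the difference between [lift_1] and L / sqrt (1 - x), rewritten so as to
     be continuous at 1/32. The bounded remainder then gives at most 2 L (1 - 32 v) = 64 L (1/32 -
     v). *)
  set (f := fun v : R =>
    (1 + 16 * v) * (16 * v * domb_series 0 v + (1 + 16 * v) * domb_series 1 v)
    - L * sqrt ((1 + 16 * v) ^ 3 / (1 + 4 * v))).
  assert (Hf : f (/ 32) = 0).
  { apply (continuous_zero_of_linear_bound f (/ 32) (64 * L)); [lra | |].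
    - apply (ex_derive_continuous (V := R_NormedModule)).
      assert (HD : forall k, ex_derive (fun v : R => domb_series k v) (/ 32)).
      { intros k. apply (ex_derive_moment domb_alt), CV_radius_domb_alt.
        rewrite Rabs_pos_eq; lra. }
      unfold f. auto_derive. repeat split; try apply HD; try lra.
    - intros v Hv. pose proof (pull_bounds v ltac:(lra)) as Hp.
      pose proof (cubic_series_singular (pull v) Hp) as Hs. cbv zeta in Hs. fold L in Hs.
      assert (Hq : sqrt ((1 + 16 * v) ^ 3 / (1 + 4 * v)) = (1 - 32 * v) / sqrt (1 - pull v)).
      { pose proof (sqrt_lt_R0 (1 - pull v) ltac:(lra)).
        apply Rmult_eq_reg_r with (sqrt (1 - pull v)); [| lra].
        unfold Rdiv at 2. rewrite Rmult_assoc, Rinv_l, Rmult_1_r by lra.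
        assert (0 < (1 + 16 * v) ^ 3) by (apply pow_lt; lra).
        rewrite <- sqrt_mult_alt by (apply Rdiv_le_0_compat; lra).
        rewrite pull_compl by lra.
        replace (_ * _) with ((1 - 32 * v) ^ 2) by (field; lra).
        apply sqrt_pow2. lra. }
      replace (f v) with ((1 - 32 * v) * (cubic_series 1 (pull v) - L / sqrt (1 - pull v))).
      + rewrite Rabs_mult, Rabs_pos_eq by lra.
        replace (64 * L * (/ 32 - v)) with ((1 - 32 * v) * (2 * L)) by field.
        apply Rmult_le_compat_l; [lra | exact Hs].
      + unfold f. rewrite Hq, <- lift_1_eq_cubic by exact Hv. unfold lift_1, Rdiv.
        pose proof (sqrt_lt_R0 (1 - pull v) ltac:(lra)). field. lra. }
  unfold f in Hf.
  replace ((1 + 16 * / 32) ^ 3 / (1 + 4 * / 32)) with 3 in Hf by field.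
  assert (E : L * sqrt 3 = 3 / (2 * PI)).
  { unfold L. pose proof (sqrt_sqrt 3 ltac:(lra)) as Hss.
    transitivity (sqrt 3 * sqrt 3 / (2 * PI)); [field; lra | rewrite Hss; reflexivity]. }
  rewrite E in Hf.
  replace (2 / PI) with (4 / 3 * (3 / (2 * PI))) by (field; lra). lra.
Qed.

Theorem theorem1 :
  is_series
    (fun n : nat =>
       INR n ^ 2 * (INR n - 1) * (9 * INR n + 1) * (Domb n / (-32) ^ n))
    (4 / (3 * PI)).
Proof.
  assert (Ha : Rabs (/ 32) < / 20) by (rewrite Rabs_pos_eq; lra).
  (* The weight expands as n^2 (n - 1) (9n + 1) = 9 n^4 - 8 n^3 - n^2. *)
  pose proof (is_pseries_quartic domb_alt 0 0 (-1) (-8) 9 (/ 32) (CV_radius_domb_alt _ Ha)) as H.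
  rewrite is_pseries_R in H.
  replace (4 / (3 * PI)) with
    (0 * domb_series 0 (/ 32) + 0 * domb_series 1 (/ 32) + -1 * domb_series 2 (/ 32)
     + -8 * domb_series 3 (/ 32) + 9 * domb_series 4 (/ 32)).
  - eapply is_series_ext; [| exact H]. intros n. cbv beta. unfold domb_alt.
    assert (E : (-1) ^ n * / 32 ^ n = / (-32) ^ n).
    { rewrite <- !pow_inv, <- Rpow_mult_distr. f_equal. field. }
    rewrite pow_inv. unfold Rdiv. rewrite <- E.
    match goal with |- ?a = ?b => change (@eq R a b) end. ring.
  (* At 1/32, eliminating the fourth and then the third series also cancels the second, leaving 2/3
     of the first-order combination. *)
  - pose proof (domb_series_3 _ Ha) as E3. pose proof (domb_series_4 _ Ha) as E4.
    pose proof domb_series_first_order as E1.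
    replace (4 / (3 * PI)) with (2 / 3 * (2 / PI)) by (field; apply PI_neq0). lra.
Qed.
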